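(* Let $d$ be a metric on $\mathfrak H_{\mathbb K}$, and denote again by $d$ its extension to $\partial\mathbf{H}^n_{\mathbb K}=\mathfrak H_{\mathbb K}\cup\{\infty\}$. Suppose that both of the following hold: (Sim) $\mathrm{Sim}_{d_{\mathfrak H}}\subseteq\mathrm{Sim}_d$; (Top) every sequence $(p_\nu)_{\nu\in\mathbb N}$ in $\partial\mathbf{H}^n_{\mathbb K}$ which converges in the $d_{\mathfrak H}$-topology of $\partial\mathbf{H}^n_{\mathbb K}$ converges in the $d$-topology of $\partial\mathbf{H}^n_{\mathbb K}$. Then: 1. If $\mathbb K=\mathbb R$, there exist constants $\beta>0$ and $\alpha\in(0,1]$ such that $d=\beta\cdot d_{\mathfrak H}^{\alpha}$. 2. If $\mathbb K\neq\mathbb R$, there exist constants $\alpha\in(0,1]$ and $\beta>0$ such that $d(p,q)\le\beta\cdot d_{\mathfrak H}^{\alpha}(p,q)$ for all $p,q\in\partial\mathbf{H}^n_{\mathbb K}$.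
   Context: $\mathbb K$ is one of $\mathbb R,\mathbb C,\mathbb H,\mathbb O$ (reals, complex numbers, quaternions, octonions), with conjugation $z\mapsto\overline z$ (the identity if $\mathbb K=\mathbb R$) and norm $|z|$; $n\ge 2$ is an integer, and $n=2$ if $\mathbb K=\mathbb O$. Put $\Im(\mathbb K)=\{z\in\mathbb K: z=-\overline z\}$, $\operatorname{Im}z=(z-\overline z)/2$, and $\|\zeta\|^2=\sum_i|\zeta_i|^2$ for $\zeta\in\mathbb K^{n-1}$. The $\mathbb K$-Heisenberg group $\mathfrak H_{\mathbb K}$ is the set $\mathbb K^{n-1}\times\Im(\mathbb K)$ with the multiplication $(\zeta,v)*(\zeta',v')=(\zeta+\zeta',\,v+v'+2\omega(\zeta,\zeta'))$, where $\omega(\zeta,\zeta')=\operatorname{Im}\big(\sum_i\overline{\zeta'_i}\zeta_i\big)$; thus $(\zeta,v)^{-1}=(-\zeta,-v)$, and the origin is $o=(0,0)$. The boundary of $\mathbb K$-hyperbolic space is identified with $\partial\mathbf{H}^n_{\mathbb K}=\mathfrak H_{\mathbb K}\cup\{\infty\}$. The Korányi gauge is $|(\zeta,v)|_{\mathbb K}=(\|\zeta\|^4+|v|^2)^{1/4}$ and the Korányi metric is $d_{\mathfrak H}(p,q)=|q^{-1}*p|_{\mathbb K}$ on $\mathfrak H_{\mathbb K}$. Any metric $d$ on $S=\mathfrak H_{\mathbb K}$ (in particular $d_{\mathfrak H}$) is extended to $\overline S=S\cup\{\infty\}$ by $d(p,\infty)=+\infty$ for $p\in S$ and $d(\infty,\infty)=0$.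 The $d$-topology on $\overline S$ is the one extending the metric topology of $S$ for which the sets $\{q\in S:d(o,q)>R\}\cup\{\infty\}$, $R>0$, are basic neighbourhoods of $\infty$. For pairwise distinct $p_1,\dots,p_4\in\overline S$ the metric cross-ratio is $|\mathbb X^d|(p_1,p_2,p_3,p_4)=\frac{d(p_4,p_2)}{d(p_4,p_1)}\cdot\frac{d(p_3,p_1)}{d(p_3,p_2)}$, where, if one of the points is $\infty$, the two factors containing $\infty$ are cancelled. The Möbius group $\mathcal M_d$ is the group of homeomorphisms of $\overline S$ (in the $d$-topology) which leave $|\mathbb X^d|$ invariant on all quadruples of pairwise distinct points. The similarity group $\mathrm{Sim}_d$ is the set of $\phi\in\mathcal M_d$ for which there is a constant $K(\phi)>0$ with $d(\phi(p),\phi(q))=K(\phi)\,d(p,q)$ for all $p,q\in S$. *)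

(* Defs.v *)
From HB Require Import structures.
From mathcomp Require Import all_boot all_order all_algebra.
From mathcomp Require Import all_classical all_reals all_analysis.
From mathcomp Require Import ring lra.
Set Implicit Arguments.
Unset Strict Implicit.
Unset Printing Implicit Defensive.
Import Order.TTheory GRing.Theory Num.Theory.
Local Open Scope classical_set_scope.
Local Open Scope ring_scope.

(** * The algebras R, C, H, O

    They are the first four steps of the Cayley-Dickson doubling: an element of
    [cd R k.+1] is a pair [(a, b)] with [a b : cd R k], with
      conj (a, b) = (conj a, - b)
      (a, b) (c, d) = (a c - conj d b, d a + b conj c)
      |(a, b)|^2 = |a|^2 + |b|^2.
    [cd R k] is only equipped with its structure of real vector space; the
    product is the explicit function [cd_mul], since [cd R 3] is not
    associative. *)

Fixpoint cd (R : realType) (k : nat) : lmodType R :=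
  if k is j.+1 then (cd R j * cd R j)%type else R^o.

Fixpoint cd_conj (R : realType) (k : nat) : cd R k -> cd R k :=
  match k with
  | 0 => fun x => x
  | j.+1 => fun x => (cd_conj x.1, - x.2)
  end.

Fixpoint cd_mul (R : realType) (k : nat) : cd R k -> cd R k -> cd R k :=
  match k with
  | 0 => fun x y => (x : R) * (y : R)
  | j.+1 => fun x y =>
      (cd_mul x.1 y.1 - cd_mul (cd_conj y.2) x.2,
       cd_mul y.2 x.1 + cd_mul x.2 (cd_conj y.1))
  end.

Fixpoint cd_normsq (R : realType) (k : nat) : cd R k -> R :=
  match k with
  | 0 => fun x => (x : R) ^+ 2
  | j.+1 => fun x => cd_normsq x.1 + cd_normsq x.2
  end.

Definition cd_norm (R : realType) (k : nat) (z : cd R k) : R :=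
  Num.sqrt (cd_normsq z).

Variant division_algebra := Reals | Complexes | Quaternions | Octonions.

Definition cd_level (K : division_algebra) : nat :=
  match K with
  | Reals => 0
  | Complexes => 1
  | Quaternions => 2
  | Octonions => 3
  end.

Definition alg (R : realType) (K : division_algebra) : lmodType R :=
  cd R (cd_level K).

Lemma cd_normsqM (R : realType) (K : division_algebra) (x y : alg R K) :
  cd_normsq (cd_mul x y) = cd_normsq x * cd_normsq y.
Proof.
have regE : (@GRing.add (cd R 0) = @GRing.add R) *
            (@GRing.opp (cd R 0) = @GRing.opp R) by [].
case: K x y => /=; first by move=> x y; rewrite exprMn.
- by move=> [a b] [c d] /=; rewrite !regE; ring.
- move=> [[a b] [c d]] [[a' b'] [c' d']] /=.
  by rewrite !regE; ring.
- move=> [[[a b] [c d]] [[e f] [g h]]] [[[a' b'] [c' d']] [[e' f'] [g' h']]] /=.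
  by rewrite !regE; ring.
Qed.

Lemma cd_conj_linear (R : realType) (k : nat) : linear (@cd_conj R k).
Proof.
elim: k => [|k IH] a x y //=.
case: x y => [x1 x2] [y1 y2]; congr pair; first exact: IH.
by rewrite /= opprD -scalerN.
Qed.

HB.instance Definition _ (R : realType) (k : nat) :=
  GRing.isLinear.Build R (cd R k) (cd R k) _ (@cd_conj R k)
    (@cd_conj_linear R k).

Lemma cd_conjK (R : realType) (k : nat) : involutive (@cd_conj R k).
Proof. by elim: k => [|k IH] // [x y] /=; rewrite IH opprK. Qed.

(** * Imaginary elements *)

Definition imaginary (R : realType) (k : nat) : {pred cd R k} :=
  [pred z | z == - cd_conj z].

Lemma imaginary_submod_closed (R : realType) (k : nat) :
  submod_closed (@imaginary R k).
Proof.
split=> [|a x y]; rewrite !inE ?linear0 ?oppr0 //.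
by move=> /eqP hx /eqP hy; rewrite linearP opprD -scalerN -hx -hy.
Qed.

HB.instance Definition _ (R : realType) (k : nat) :=
  GRing.isSubmodClosed.Build R (cd R k) (@imaginary R k)
    (@imaginary_submod_closed R k).

Record im_space (R : realType) (k : nat) := ImSpace {
  im_val :> cd R k;
  im_valP : im_val \in @imaginary R k
}.

HB.instance Definition _ (R : realType) (k : nat) :=
  [isSub for @im_val R k].
HB.instance Definition _ (R : realType) (k : nat) :=
  [Choice of im_space R k by <:].
HB.instance Definition _ (R : realType) (k : nat) :=
  [SubChoice_isSubLmodule of im_space R k by <:].

Lemma im_part_subproof (R : realType) (k : nat) (z : cd R k) :
  2^-1 *: (z - cd_conj z) \in @imaginary R k.
Proof.
have e : cd_conj (z - cd_conj z) = cd_conj z - z by rewrite linearB /= cd_conjK.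
by rewrite inE linearZ /= e -scalerN opprB.
Qed.

Definition im_part (R : realType) (k : nat) (z : cd R k) : im_space R k :=
  ImSpace (im_part_subproof z).

(** * The Heisenberg group *)

Definition heis (R : realType) (K : division_algebra) (n : nat) : Type :=
  ({ffun 'I_n.-1 -> alg R K} * im_space R (cd_level K))%type.

HB.instance Definition _ (R : realType) (K : division_algebra) (n : nat) :=
  Choice.on (heis R K n).

Definition heis_omega (R : realType) (K : division_algebra) (n : nat)
    (z w : {ffun 'I_n.-1 -> alg R K}) : im_space R (cd_level K) :=
  im_part (\sum_i cd_mul (cd_conj (w i)) (z i)).

Definition heis_mul (R : realType) (K : division_algebra) (n : nat)
    (p q : heis R K n) : heis R K n :=
  (p.1 + q.1, p.2 + q.2 + 2 *: heis_omega p.1 q.1).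

Definition heis_inv (R : realType) (K : division_algebra) (n : nat)
    (p : heis R K n) : heis R K n := (- p.1, - p.2).

Definition heis_o (R : realType) (K : division_algebra) (n : nat) :
  heis R K n := (0, 0).

Definition heis_normsq (R : realType) (K : division_algebra) (n : nat)
    (z : {ffun 'I_n.-1 -> alg R K}) : R := \sum_i cd_norm (z i) ^+ 2.

Definition koranyi_gauge (R : realType) (K : division_algebra) (n : nat)
    (p : heis R K n) : R :=
  (heis_normsq p.1 ^+ 2 + cd_norm (im_val p.2) ^+ 2) `^ 4^-1.

Definition koranyi_dist (R : realType) (K : division_algebra) (n : nat)
    (p q : heis R K n) : R := koranyi_gauge (heis_mul (heis_inv q) p).

(** * Metrics and their extension by a point at infinity

    [None] is the point at infinity of [option S].  Several metrics on the same
    set are compared, hence a predicate on distance functions and not a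
    canonical [metricType]. *)

Record is_metric (R : realType) (S : Type) (d : S -> S -> R) : Prop := IsMetric {
  metric_ge0 : forall p q, 0 <= d p q;
  metric_eq0 : forall p q, d p q = 0 <-> p = q;
  metric_sym : forall p q, d p q = d q p;
  metric_triangle : forall p q r, d p r <= d p q + d q r
}.

Definition ext_dist (R : realType) (S : Type) (d : S -> S -> R)
    (p q : option S) : \bar R :=
  match p, q with
  | Some x, Some y => (d x y)%:E
  | None, None => 0%E
  | _, _ => +oo%E
  end.

(** [ext_space o d] is [option S] with the [d]-topology, [o] being the base
    point.  It is given by its open sets so as to make sense for every function
    [d]; [ext_nbhs_fin] and [ext_nbhs_infty] below show that for a
    metric [d] the neighbourhoods are the expected ones. *)

Definition ext_space (R : realType) (S : choiceType) (o : S)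
  (d : S -> S -> R) : Type := option S.

Section ext_topology.
Context (R : realType) (S : choiceType) (o : S) (d : S -> S -> R).

HB.instance Definition _ := Choice.on (ext_space o d).

Definition ext_open : set_system (ext_space o d) := [set U |
  (forall p : S, U (Some p) ->
     exists2 e : R, 0 < e & forall q, d p q < e -> U (Some q)) /\
  (U None -> exists2 r : R, 0 < r & forall q, r < d o q -> U (Some q))].

Lemma ext_openT : ext_open setT.
Proof. by split=> [p|] _; exists 1. Qed.

Lemma ext_openI : setI_closed ext_open.
Proof.
move=> A B [A1 A2] [B1 B2]; split=> [p|] [].
- move=> /A1[e e0 eA] /B1[f f0 fB]; exists (Num.min e f).
    by rewrite lt_min e0.
  by move=> q; rewrite lt_min => /andP[/eA ? /fB ?].
- move=> /A2[e e0 eA] /B2[f f0 fB]; exists (Num.max e f).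
    by rewrite lt_max e0.
  by move=> q; rewrite gt_max => /andP[/eA ? /fB ?].
Qed.

Lemma ext_open_bigU (I : Type) (f : I -> set (ext_space o d)) :
  (forall i, ext_open (f i)) -> ext_open (\bigcup_i f i).
Proof.
move=> fo; split=> [p|] [i _ fi].
- by have [e e0 ei] := (fo i).1 _ fi; exists e => // q /ei ?; exists i.
- by have [e e0 ei] := (fo i).2 fi; exists e => // q /ei ?; exists i.
Qed.

HB.instance Definition _ := @isOpenTopological.Build (ext_space o d)
  ext_open ext_openT ext_openI ext_open_bigU.

Lemma ext_nbhs_fin (hd : is_metric d) (p : S) (A : set (ext_space o d)) :
  nbhs (Some p : ext_space o d) A <->
  exists2 e : R, 0 < e & forall q, d p q < e -> A (Some q).
Proof.
split=> [[U [oU Up UA]]|[e e0 eA]].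
  by have [e e0 eU] := oU.1 _ Up; exists e => // q /eU /UA.
exists [set x | exists2 q, x = Some q & d p q < e]; split=> //=.
- split=> [q [_ [<-] pq]|[]//].
  exists (e - d p q) => [|r qr]; first by rewrite subr_gt0.
  exists r => //; rewrite (le_lt_trans (metric_triangle hd p q r))//.
  by rewrite -ltrBrDl.
- by exists p => //; rewrite (metric_eq0 hd p p).2.
- by move=> _ [q -> /eA].
Qed.

Lemma ext_nbhs_infty (hd : is_metric d) (A : set (ext_space o d)) :
  nbhs (None : ext_space o d) A <->
  A None /\ exists2 r : R, 0 < r & forall q, r < d o q -> A (Some q).
Proof.
split=> [[U [oU Up UA]]|[AN [r r0 rA]]].
  split; first exact: UA.
  by have [r r0 rU] := oU.2 Up; exists r => // q /rU /UA.
exists [set x | if x is Some q then r < d o q else True]; split=> //=.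
- split=> [q rq|_]; last by exists r.
  exists (d o q - r) => [|s qs]; first by rewrite subr_gt0.
  have := metric_triangle hd o s q; rewrite (metric_sym hd s q) => tri.
  by simpl in *; lra.
- by move=> [q|] //= /rA.
Qed.

End ext_topology.

(** * Möbius maps and similarities *)

(** The factor attached to a point at infinity is replaced by [1].  Every point
    occurs in exactly one numerator and one denominator of the cross-ratio, so
    this is the cancellation of the two factors containing infinity. *)
Definition cross_factor (R : realType) (S : Type) (d : S -> S -> R)
    (p q : option S) : R :=
  match p, q with
  | Some x, Some y => d x y
  | _, _ => 1
  end.

Definition cross_ratio (R : realType) (S : Type) (d : S -> S -> R)
    (p1 p2 p3 p4 : option S) : R :=
  cross_factor d p4 p2 / cross_factor d p4 p1 *
  (cross_factor d p3 p1 / cross_factor d p3 p2).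

Definition homeomorphism (T U : topologicalType) (f : T -> U) : Prop :=
  continuous f /\
  exists g : U -> T, [/\ cancel f g, cancel g f & continuous g].

Definition moebius (R : realType) (S : choiceType) (o : S) (d : S -> S -> R) :
    set (option S -> option S) :=
  [set phi | homeomorphism (phi : ext_space o d -> ext_space o d) /\
    forall p1 p2 p3 p4 : option S, uniq [:: p1; p2; p3; p4] ->
      cross_ratio d (phi p1) (phi p2) (phi p3) (phi p4) =
      cross_ratio d p1 p2 p3 p4].

Definition similarity (R : realType) (S : choiceType) (o : S)
    (d : S -> S -> R) : set (option S -> option S) :=
  [set phi | moebius o d phi /\
    exists2 k : R, 0 < k & forall p q : S,
      ext_dist d (phi (Some p)) (phi (Some q)) = (k * d p q)%:E].

Definition convergent (T : topologicalType) (u : nat -> T) : Prop :=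
  exists l : T, u @ \oo --> l.

(* Main.v *)
Require Import Defs.
From HB Require Import structures.
From mathcomp Require Import all_boot all_order all_algebra.
From mathcomp Require Import all_classical all_reals all_analysis.
From mathcomp Require Import ring lra.
Set Implicit Arguments.
Unset Strict Implicit.
Unset Printing Implicit Defensive.
Import Order.TTheory GRing.Theory Num.Theory.
Local Open Scope classical_set_scope.
Local Open Scope ring_scope.

(** Left translations and the dilations (z, v) |-> (r z, r^2 v) are Korányi
    similarities, so by (Sim) they multiply [d] by constants; the whole proof
    consists in finding these constants.

    A similarity of [d] has a unique ratio as soon as the group has two points,
    and the ratio of a composite is the product of the ratios.  For a
    translation by a horizontal element a = (z, 0) or a vertical one
    a = (0, v), the dilation of factor 2 sends a to the power a^2 or a^4, so
    the translation by this power is conjugate to the translation by a and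
    has the same ratio k: thus k^m = k with m > 1, and k = 1
    ([transl_isometry_of_pow]).  Since (z, v) = (z, 0) * (0, v), the metric [d]
    is left-invariant ([transl_isometry]), and only distances to the origin
    matter.

    (Top) says that the identity is continuous from the Korányi topology to the
    [d]-topology: interleaving a sequence tending to p with the constant p
    forces the [d]-limit to be p ([identity_continuous]).  Hence the ratio k(r)
    of the dilation of factor r, which is multiplicative in r, tends to 0 with
    r.  An additive function bounded above on a half-line is linear
    ([additive_bounded_above_linear]), so k(r) = r^alpha.  The exponent is
    positive because k(r) tends to 0, and at most 1 because the dilation of
    factor 2 sends a horizontal e to e * e, so that
    2^alpha d(o, e) <= 2 d(o, e) by the triangle inequality
    ([dil_scales_powR]).

    For the upper bound, points of small gauge are at [d]-distance less than 1
    from the origin, and every point is a dilate of such a point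
    ([gauge_upper_bound]).

    Over the reals the group is Euclidean space, and any two vectors of the same
    length are exchanged by a reflection.  A reflection is an involutive
    similarity, so its ratio squares to 1 and is 1: the distance d(o, p) depends
    only on the gauge of p, and the dilations determine it
    ([real_snowflake]).

    To apply (Sim), translations must be homeomorphisms of the compactified
    group, so they must preserve neighbourhoods of infinity.  The crude bound
    [koranyi_gauge_mul_bounded] is enough for this. *)

(** * The Cayley-Dickson algebras *)

Section CayleyDickson.
Context (R : realType).

(** In each component of a doubled product both factors enter linearly, but the
    left factor of the double also enters as a right factor; hence both
    linearities are needed at once for the induction. *)
Lemma cd_mul_bilinear k :
  (forall a (x y z : cd R k),
     cd_mul (a *: x + y) z = a *: cd_mul x z + cd_mul y z) /\
  (forall a (x y z : cd R k),
     cd_mul z (a *: x + y) = a *: cd_mul z x + cd_mul z y).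
Proof.
elim: k => [|k [IHl IHr]].
  by split=> a x y z /=; rewrite /GRing.scale /=;
    [rewrite mulrDl mulrA|rewrite mulrDr mulrCA].
split=> a [x1 x2] [y1 y2] [z1 z2] /=; congr pair => /=;
  rewrite ?linearP /= ?IHl ?IHr !(scalerDr, scalerN, scalerBr) ?opprD ?scalerN;
  by rewrite -!addrA; congr (_ + _); rewrite addrCA.
Qed.

Lemma cd_mul_linearl k (z : cd R k) : linear (fun x => cd_mul x z).
Proof. by move=> a x y; rewrite (cd_mul_bilinear k).1. Qed.

Lemma cd_mul_linearr k (z : cd R k) : linear (cd_mul z).
Proof. by move=> a x y; rewrite (cd_mul_bilinear k).2. Qed.

HB.instance Definition _ k (z : cd R k) :=
  GRing.isLinear.Build R (cd R k) (cd R k) _ (cd_mul z) (cd_mul_linearr z).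

(** [cd_mul] in its left argument, named in order to carry the structure of a
    linear map. *)
Definition cd_mulr k (z x : cd R k) := cd_mul x z.

HB.instance Definition _ k (z : cd R k) :=
  GRing.isLinear.Build R (cd R k) (cd R k) _ (cd_mulr z) (cd_mul_linearl z).

(* The next two equations keep the doubling step foldable: simplification would
   expose the underlying fixpoints. *)
Lemma cd_mulS k (a b c d : cd R k) :
  @cd_mul R k.+1 (a, b) (c, d) =
  (cd_mul a c - cd_mul (cd_conj d) b, cd_mul d a + cd_mul b (cd_conj c)).
Proof. by []. Qed.

Lemma cd_conjS k (a b : cd R k) : @cd_conj R k.+1 (a, b) = (cd_conj a, - b).
Proof. by []. Qed.

Lemma cd_conjM k (x y : cd R k) :
  cd_conj (cd_mul x y) = cd_mul (cd_conj y) (cd_conj x).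
Proof.
elim: k x y => [|k IH] x y; first exact: mulrC.
have mulNl (u v : cd R k) : cd_mul (- u) v = - cd_mul u v.
  exact: (linearN (@cd_mulr k v)).
case: x y => [a b] [c d].
rewrite cd_mulS !cd_conjS cd_mulS !mulNl !linearN /= linearB /= opprK.
by rewrite !IH !mulNl !cd_conjK opprD; congr pair; rewrite addrC.
Qed.

Lemma cd_normsq_ge0 k (x : cd R k) : 0 <= cd_normsq x.
Proof. by elim: k x => [|k IH] x /=; [exact: sqr_ge0|rewrite addr_ge0]. Qed.

Lemma cd_normsq_eq0 k (x : cd R k) : (cd_normsq x == 0) = (x == 0).
Proof.
elim: k x => [|k IH] x /=; first exact: sqrf_eq0.
by rewrite paddr_eq0 ?cd_normsq_ge0// !IH.
Qed.

Lemma sqr_cd_norm k (x : cd R k) : cd_norm x ^+ 2 = cd_normsq x.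
Proof. by rewrite sqr_sqrtr ?cd_normsq_ge0. Qed.

Lemma cd_normsqZ k a (x : cd R k) : cd_normsq (a *: x) = a ^+ 2 * cd_normsq x.
Proof. by elim: k x => [|k IH] x /=; [exact: exprMn|rewrite !IH mulrDr]. Qed.

Lemma cd_normsqN k (x : cd R k) : cd_normsq (- x) = cd_normsq x.
Proof. by rewrite -scaleN1r cd_normsqZ sqrrN expr1n mul1r. Qed.

Lemma cd_normsqJ k (x : cd R k) : cd_normsq (cd_conj x) = cd_normsq x.
Proof. by elim: k x => [|k IH] x //=; rewrite IH cd_normsqN. Qed.

Lemma cd_normsqD k (x y : cd R k) :
  cd_normsq (x + y) <= 2 * (cd_normsq x + cd_normsq y).
Proof.
elim: k x y => [|k IH] x y /=; last first.
  have := IH x.1 y.1; have := IH x.2 y.2; lra.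
change ((x + y : R) ^+ 2 <= 2 * ((x : R) ^+ 2 + (y : R) ^+ 2)).
move: (x : R) (y : R) => {}x {}y.
have := sqr_ge0 (x - y); nra.
Qed.

(** A crude substitute for the triangle inequality of the norm: only the
    existence of a bound depending on the number of terms matters below. *)
Lemma cd_normsq_sum k (I : Type) (s : seq I) (f : I -> cd R k) :
  cd_normsq (\sum_(i <- s) f i) <= 2 ^+ size s * \sum_(i <- s) cd_normsq (f i).
Proof.
elim: s => [|i s IH].
  by rewrite !big_nil mulr0 le_eqVlt cd_normsq_eq0 eqxx.
rewrite !big_cons (le_trans (cd_normsqD _ _))//= exprS -mulrA ler_pM2l//.
rewrite mulrDr lerD// ler_peMl ?cd_normsq_ge0//.
by rewrite -[leLHS](expr1n _ (size s)) lerXn2r ?nnegrE// ler1n.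
Qed.

Lemma cd_neq0 k : exists z : cd R k, z != 0.
Proof.
elim: k => [|k [z z0]]; first by exists (1 : R); exact: oner_neq0.
by exists (z, 0); apply: contra z0 => /eqP[->].
Qed.
End CayleyDickson.

(** * The Heisenberg group and its dilations *)

Section ImPart.
Context (R : realType) (k : nat).

Lemma im_part_linear : linear (@im_part R k).
Proof.
move=> a x y; apply: val_inj; rewrite linearP /=.
by rewrite linearP opprD addrACA -scalerBr scalerDr !scalerA mulrC.
Qed.

HB.instance Definition _ :=
  GRing.isLinear.Build R (cd R k) (im_space R k) _ (@im_part R k)
    im_part_linear.

Lemma im_part_conj (z : cd R k) : im_part (cd_conj z) = - im_part z.
Proof. by apply: val_inj; rewrite linearN /= cd_conjK -scalerN opprB. Qed.

Lemma cd_normsq_im_part (z : cd R k) :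
  cd_normsq (im_val (im_part z)) <= cd_normsq z.
Proof.
rewrite /= cd_normsqZ.
have := cd_normsqD z (- cd_conj z); rewrite cd_normsqN cd_normsqJ.
rewrite -(ler_pM2l (_ : 0 < 2^-1 ^+ 2 :> R)) ?exprn_gt0 ?invr_gt0//.
move=> /le_trans; apply; lra.
Qed.
End ImPart.

Section HeisenbergGroup.
Context (R : realType) (K : division_algebra) (n : nat).
Implicit Types (z w : {ffun 'I_n.-1 -> alg R K}) (p q a : heis R K n).

Lemma heis_omega_linearl w : linear (fun z => heis_omega z w).
Proof.
move=> a x y; rewrite /heis_omega -linearP; congr im_part.
rewrite scaler_sumr -big_split; apply: eq_bigr => i _ /=.
by rewrite !ffunE linearP.
Qed.

Lemma heis_omegaC z w : heis_omega z w = - heis_omega w z.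
Proof.
rewrite /heis_omega -im_part_conj; congr im_part.
by rewrite linear_sum; apply: eq_bigr => i _; rewrite /= cd_conjM cd_conjK.
Qed.

Lemma heis_omega_linearr z : linear (fun w => heis_omega z w).
Proof.
by move=> a x y; rewrite heis_omegaC heis_omega_linearl opprD -scalerN -!heis_omegaC.
Qed.

Lemma heis_omegaDl z z' w :
  heis_omega (z + z') w = heis_omega z w + heis_omega z' w.
Proof. by have := heis_omega_linearl w 1 z z'; rewrite !scale1r. Qed.

Lemma heis_omegaDr z w w' :
  heis_omega z (w + w') = heis_omega z w + heis_omega z w'.
Proof. by have := heis_omega_linearr z 1 w w'; rewrite !scale1r. Qed.

Lemma heis_omega0l w : heis_omega 0 w = 0 :> im_space R (cd_level K).
Proof.
by have := heis_omega_linearl w (-1) 0 0; rewrite scaler0 addr0 scaleN1r addNr.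
Qed.

Lemma heis_omegaZl c z w : heis_omega (c *: z) w = c *: heis_omega z w.
Proof. by have := heis_omega_linearl w c z 0; rewrite heis_omega0l !addr0. Qed.

Lemma heis_omegaZr c z w : heis_omega z (c *: w) = c *: heis_omega z w.
Proof. by rewrite heis_omegaC heis_omegaZl -scalerN -heis_omegaC. Qed.

Lemma heis_omega0r z : heis_omega z 0 = 0.
Proof. by rewrite heis_omegaC heis_omega0l oppr0. Qed.

Lemma heis_omegaNl z w : heis_omega (- z) w = - heis_omega z w.
Proof. by rewrite -scaleN1r heis_omegaZl scaleN1r. Qed.

Lemma heis_omegaNr z w : heis_omega z (- w) = - heis_omega z w.
Proof. by rewrite -scaleN1r heis_omegaZr scaleN1r. Qed.

Lemma heis_omega_alt z : heis_omega z z = 0.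
Proof.
apply/eqP; have /eqP := heis_omegaC z z.
by rewrite -addr_eq0 -mulr2n -scaler_nat scaler_eq0 pnatr_eq0.
Qed.

Lemma heis_mulA p q a : heis_mul p (heis_mul q a) = heis_mul (heis_mul p q) a.
Proof.
rewrite /heis_mul /= addrA heis_omegaDl heis_omegaDr !scalerDr; congr pair.
rewrite -!addrA; congr (_ + (_ + _)).
by rewrite [RHS]addrCA; congr (_ + _); rewrite addrC addrA.
Qed.

Lemma heis_mul0 p : heis_mul p (heis_o R K n) = p.
Proof. by case: p => z v; rewrite /heis_mul /= heis_omega0r scaler0 !addr0. Qed.

Lemma heis_mulK a : cancel (heis_mul a) (heis_mul (heis_inv a)).
Proof.
move=> p; rewrite heis_mulA /heis_mul /heis_inv /=.
rewrite heis_omegaNl heis_omega_alt oppr0 scaler0 !addNr addr0 add0r.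
by rewrite heis_omega0l scaler0 addr0 add0r; case: p.
Qed.

Lemma heis_invK : involutive (@heis_inv R K n).
Proof. by move=> [z v]; rewrite /heis_inv /= !opprK. Qed.

Lemma heis_mulVK a : cancel (heis_mul (heis_inv a)) (heis_mul a).
Proof. by move=> p; rewrite -{1}[a]heis_invK heis_mulK. Qed.

Lemma heis_invM p q :
  heis_inv (heis_mul p q) = heis_mul (heis_inv q) (heis_inv p).
Proof.
rewrite /heis_inv /heis_mul /= heis_omegaNl heis_omegaNr opprK.
rewrite (heis_omegaC q.1) scalerN !opprD [- q.1 + _]addrC.
by rewrite [- q.2 + _]addrC.
Qed.

(** The exponent 2 on the vertical part makes the dilation an automorphism, since
    [heis_omega] is bilinear, and homogeneous of degree 1 for the gauge. *)
Definition heis_dil (r : R) p : heis R K n := (r *: p.1, r ^+ 2 *: p.2).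

Lemma heis_dilM r p q :
  heis_dil r (heis_mul p q) = heis_mul (heis_dil r p) (heis_dil r q).
Proof.
rewrite /heis_dil /heis_mul /= heis_omegaZl heis_omegaZr !scalerDr.
by rewrite !scalerA mulrC expr2 mulrA.
Qed.

Lemma heis_dilV r p : heis_dil r (heis_inv p) = heis_inv (heis_dil r p).
Proof. by rewrite /heis_dil /heis_inv /= !scalerN. Qed.

Lemma heis_dilA r s p : heis_dil r (heis_dil s p) = heis_dil (r * s) p.
Proof. by rewrite /heis_dil /= !scalerA exprMn. Qed.

Lemma heis_dil1 p : heis_dil 1 p = p.
Proof. by case: p => z v; rewrite /heis_dil /= expr1n !scale1r. Qed.

Lemma heis_dilK r : r != 0 -> cancel (heis_dil r) (heis_dil r^-1).
Proof. by move=> r0 p; rewrite heis_dilA mulVf// heis_dil1. Qed.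

Lemma heis_dilo r : heis_dil r (heis_o R K n) = heis_o R K n.
Proof. by rewrite /heis_dil /= !scaler0. Qed.

(** * The Korányi gauge *)

Lemma heis_normsqE z : heis_normsq z = \sum_i cd_normsq (z i).
Proof. by apply: eq_bigr => i _; rewrite sqr_cd_norm. Qed.

Lemma heis_normsq_ge0 z : 0 <= heis_normsq z.
Proof. by apply: sumr_ge0 => i _; apply: sqr_ge0. Qed.

Lemma heis_normsq_eq0 z : (heis_normsq z == 0) = (z == 0).
Proof.
rewrite heis_normsqE; apply/eqP/eqP => [z0|->]; last first.
  by rewrite big1// => i _; apply/eqP; rewrite ffunE cd_normsq_eq0.
apply/ffunP => i; apply/eqP; rewrite ffunE -cd_normsq_eq0.
apply/eqP/(psumr_eq0P _ z0) => // j _; exact: cd_normsq_ge0.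
Qed.

Lemma heis_normsqZ (r : R) z : heis_normsq (r *: z) = r ^+ 2 * heis_normsq z.
Proof.
rewrite !heis_normsqE mulr_sumr; apply: eq_bigr => i _.
by rewrite ffunE cd_normsqZ.
Qed.

Lemma heis_normsqD z w : heis_normsq (z + w) <= 2 * (heis_normsq z + heis_normsq w).
Proof.
rewrite !heis_normsqE -big_split mulr_sumr ler_sum// => i _.
by rewrite ffunE cd_normsqD.
Qed.

(** Multiplicativity of the norm enters only here; it bounds the vertical
    displacement produced by a product. *)
Lemma heis_omega_bound : exists2 C : R, 0 <= C & forall z w,
  cd_normsq (im_val (heis_omega z w)) <= C * (heis_normsq z * heis_normsq w).
Proof.
exists (2 ^+ size (index_enum ('I_n.-1))) => [|z w]; first exact: exprn_ge0.
rewrite (le_trans (cd_normsq_im_part _))// (le_trans (cd_normsq_sum _ _))//.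
rewrite ler_pM2l ?exprn_gt0// (heis_normsqE w) mulr_sumr ler_sum// => i _.
rewrite cd_normsqM cd_normsqJ mulrC ler_wpM2r ?cd_normsq_ge0//.
rewrite heis_normsqE (bigD1 i)//= lerDl.
by apply: sumr_ge0 => j _; apply: cd_normsq_ge0.
Qed.

Lemma koranyi_gauge_ge0 p : 0 <= koranyi_gauge p.
Proof. exact: powR_ge0. Qed.

(** All computations with the gauge go through its fourth power, a polynomial in
    the norms. *)
Lemma koranyi_gaugeX4 p :
  koranyi_gauge p ^+ 4 = heis_normsq p.1 ^+ 2 + cd_normsq (im_val p.2).
Proof.
rewrite -powR_mulrn ?koranyi_gauge_ge0// -powRrM mulVf// powRr1 ?sqr_cd_norm//.
by rewrite addr_ge0 ?sqr_ge0 ?cd_normsq_ge0.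
Qed.

Lemma koranyi_gauge_eq0 p : (koranyi_gauge p == 0) = (p == heis_o R K n).
Proof.
have -> : (koranyi_gauge p == 0) = (koranyi_gauge p ^+ 4 == 0) by rewrite expf_eq0.
rewrite koranyi_gaugeX4 paddr_eq0 ?sqr_ge0 ?cd_normsq_ge0// sqrf_eq0.
by rewrite heis_normsq_eq0 cd_normsq_eq0; case: p.
Qed.

Lemma koranyi_gauge_dil (r : R) p :
  0 <= r -> koranyi_gauge (heis_dil r p) = r * koranyi_gauge p.
Proof.
move=> r0; apply/eqP; rewrite -(@eqrXn2 _ 4)// ?mulr_ge0 ?koranyi_gauge_ge0//.
rewrite exprMn !koranyi_gaugeX4 /heis_dil /= heis_normsqZ cd_normsqZ.
by apply/eqP; ring.
Qed.

Lemma koranyi_gaugeN p : koranyi_gauge (heis_inv p) = koranyi_gauge p.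
Proof.
apply/eqP; rewrite -(@eqrXn2 _ 4)// ?koranyi_gauge_ge0//.
by rewrite !koranyi_gaugeX4 /heis_inv /= cd_normsqN -scaleN1r heis_normsqZ
  sqrrN expr1n mul1r.
Qed.

(** Translations map bounded sets to bounded sets, which makes them continuous at
    infinity. *)
Lemma koranyi_gauge_mul_bounded a (r : R) : exists2 r', 0 < r' &
  forall p, koranyi_gauge p <= r -> koranyi_gauge (heis_mul a p) <= r'.
Proof.
have [C C0 hC] := heis_omega_bound.
(* [M] is at least 1, so that a bound [M] on the square of a norm is also a
   bound on the norm. *)
set M := 1 + r ^+ 4.
set M1 := 2 * (heis_normsq a.1 + M).
set M2 := 2 * (2 * (cd_normsq (im_val a.2) + M) + 4 * (C * (heis_normsq a.1 * M))).
have M_ge1 : 1 <= M by rewrite lerDl -[4%N]/(2 * 2)%N exprM sqr_ge0.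
have a0 := heis_normsq_ge0 a.1.
have a0' := cd_normsq_ge0 (im_val a.2).
have M_ge0 : 0 <= M by exact: le_trans M_ge1.
have M1_ge0 : 0 <= M1 by rewrite mulr_ge0// addr_ge0.
have M2_ge0 : 0 <= M2.
  apply: mulr_ge0 => //; apply: addr_ge0; apply: mulr_ge0 => //.
    exact: addr_ge0.
  by apply: mulr_ge0 => //; apply: mulr_ge0.
exists (1 + (M1 ^+ 2 + M2)) => [|p pr].
  by rewrite ltr_pwDl// addr_ge0// sqr_ge0.
have pM : heis_normsq p.1 ^+ 2 + cd_normsq (im_val p.2) <= M.
  rewrite -koranyi_gaugeX4 (@le_trans _ _ (r ^+ 4))// ?lerDr//.
  rewrite lerXn2r// ?nnegrE ?koranyi_gauge_ge0//.
  by rewrite (le_trans _ pr)// koranyi_gauge_ge0.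
have p0 := heis_normsq_ge0 p.1.
have p0' := cd_normsq_ge0 (im_val p.2).
have p1M : heis_normsq p.1 <= M.
  have [p1|/ltW p1] := leP (heis_normsq p.1) 1; first exact: le_trans p1 _.
  apply: le_trans pM; rewrite (@le_trans _ _ (heis_normsq p.1 ^+ 2)) ?lerDl//.
  by rewrite ler_eXnr.
have p2M : cd_normsq (im_val p.2) <= M by rewrite (le_trans _ pM)// lerDr sqr_ge0.
rewrite -(@ler_pXn2r _ 4)// ?nnegrE ?koranyi_gauge_ge0//; last first.
  by rewrite addr_ge0// addr_ge0// sqr_ge0.
set X := M1 ^+ 2 + M2.
have X0 : 0 <= X by rewrite addr_ge0// sqr_ge0.
apply: (@le_trans _ _ X); last first.
  by rewrite (@le_trans _ _ (1 + X)) ?lerDr// ler_eXnr// lerDl.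
rewrite koranyi_gaugeX4 lerD//.
  rewrite lerXn2r// ?nnegrE ?heis_normsq_ge0//.
  by rewrite (le_trans (heis_normsqD _ _))// ler_pM2l// lerD2l.
rewrite /= (le_trans (cd_normsqD _ _))// ler_pM2l// lerD//.
  by rewrite (le_trans (cd_normsqD _ _))// ler_pM2l// lerD2l.
rewrite cd_normsqZ -natrX ler_pM2l// (le_trans (hC _ _))//.
by rewrite ler_wpM2l// ler_wpM2l.
Qed.

Lemma koranyi_distMl a p q :
  koranyi_dist (heis_mul a p) (heis_mul a q) = koranyi_dist p q.
Proof. by rewrite /koranyi_dist heis_invM -heis_mulA heis_mulK. Qed.

Lemma koranyi_dist_dil (r : R) p q : 0 <= r ->
  koranyi_dist (heis_dil r p) (heis_dil r q) = r * koranyi_dist p q.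
Proof.
by move=> r0; rewrite /koranyi_dist -heis_dilV -heis_dilM koranyi_gauge_dil.
Qed.

Lemma koranyi_distol p : koranyi_dist (heis_o R K n) p = koranyi_gauge p.
Proof. by rewrite /koranyi_dist heis_mul0 koranyi_gaugeN. Qed.

End HeisenbergGroup.

(** * Similarities fixing infinity *)

Section Similarities.
Context (R : realType) (S : choiceType) (o : S) (d : S -> S -> R).

Definition scales (k : R) (f : S -> S) :=
  0 < k /\ forall p q, d (f p) (f q) = k * d p q.

(** Continuity at infinity of the extension of [f] fixing infinity. *)
Definition proper_at_infty (f : S -> S) :=
  forall r, exists2 r', 0 < r' & forall q, r' < d o q -> r < d o (f q).

Lemma scales_inv k f g : cancel g f -> scales k f -> scales k^-1 g.
Proof.
move=> gK [k0 fk]; split=> [|p q]; first by rewrite invr_gt0.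
by rewrite -{2}(gK p) -{2}(gK q) fk mulKf// gt_eqF.
Qed.

Lemma scales_comp k l f g :
  scales k f -> scales l g -> scales (k * l) (f \o g).
Proof.
by move=> [k0 fk] [l0 gl]; split=> [|p q]; rewrite ?mulr_gt0//= fk gl mulrA.
Qed.

Lemma scales_proper k f : scales k f -> f o = o -> proper_at_infty f.
Proof.
move=> [k0 fk] fo r; exists (`|r| / k + 1) => [|q].
  by rewrite ltr_wpDl// mulr_ge0// invr_ge0 ltW.
rewrite -{2}fo fk => rq; rewrite mulrC -ltr_pdivrMr//.
rewrite (le_lt_trans _ rq)// (@le_trans _ _ (`|r| / k)) ?lerDl//.
by rewrite ler_pM2r ?invr_gt0// ler_norm.
Qed.

Lemma omap_continuous k f : scales k f -> proper_at_infty f ->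
  continuous (omap f : ext_space o d -> ext_space o d).
Proof.
move=> [k0 fk] fp; apply/continuousP => U [U1 U2]; split=> [p|] /= Up.
- have [e e0 eU] := U1 _ Up; exists (e / k); first exact: divr_gt0.
  by move=> q; rewrite ltr_pdivlMr// mulrC -fk; exact: eU.
- have [r r0 rU] := U2 Up; have [r' r'0 r'f] := fp r.
  by exists r' => // q /r'f; exact: rU.
Qed.

(** The cross-ratio is preserved because it has as many factors in the numerator
    as in the denominator, also after the cancellation at infinity. *)
Lemma similarity_omap k f g : cancel f g -> cancel g f -> scales k f ->
  proper_at_infty f -> proper_at_infty g -> similarity o d (omap f).
Proof.
move=> fK gK kf fp gp; have [k0 fk] := kf.
split; last by exists k => // p q; rewrite /= fk.
split.
  split; first exact: omap_continuous kf fp.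
  exists (omap g); split; first exact: omapK.
    exact: omapK.
  exact: omap_continuous (scales_inv gK kf) gp.
have k_cancel x y : k * x / (k * y) = x / y.
  by rewrite -mulf_div divff ?mul1r// gt_eqF.
move=> [p1|] [p2|] [p3|] [p4|]; rewrite /= ?inE ?eqxx ?orbT ?andbF // => _;
  rewrite /cross_ratio /= ?fk ?invr1 ?mul1r ?mulr1 ?k_cancel //.
by rewrite ![_^-1 * _]mulrC k_cancel.
Qed.

End Similarities.

(** * Two consequences of boundedness and convergence *)

(** If [L t > 0] for some [t < 0], then the multiples of [t] are in the half-line
    but the values [L (m t) = m L t] are unbounded.  So [L] is nonpositive on the
    negative reals, that is, nondecreasing; being linear on the integers, it
    differs from [t |-> t L 1] by at most [L 1], and the same bound for all
    multiples of [t] makes the difference zero. *)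
Lemma additive_bounded_above_linear (R : realType) (L : R -> R) (a M : R) :
  (forall s t, L (s + t) = L s + L t) -> (forall t, t < a -> L t <= M) ->
  forall t, L t = t * L 1.
Proof.
move=> LD LM.
have LMn t m : L (t *+ m) = L t *+ m.
  elim: m => [|m IH]; last by rewrite !mulrS LD IH.
  by apply: (addrI (L 0)); rewrite -LD !mulr0n !addr0.
have L0 : L 0 = 0 by have := LMn 0 0%N; rewrite !mulr0n.
have LN t : L (- t) = - L t by apply/eqP; rewrite -addr_eq0 -LD addNr L0.
have LMz t (m : int) : L (t *~ m) = L t *~ m.
  by case: m => m; rewrite ?NegzE ?mulrNz ?LN -!pmulrn LMn.
have multiples_unbounded (x y : R) : 0 < x -> exists m : nat, y < x *+ m.
  move=> x0; exists (Num.bound (`|y| / x)).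
  have /archi_boundP : 0 <= `|y| / x by rewrite divr_ge0// ltW.
  by rewrite ltr_pdivrMr// mulr_natl => /(le_lt_trans (ler_norm y)).
have L_le0 t : t < 0 -> L t <= 0.
  move=> t0; rewrite leNgt; apply/negP => Lt0.
  have [m ma] := @multiples_unbounded (- t) (- a) ltac:(by rewrite oppr_gt0).
  have [m' m'M] := multiples_unbounded _ M Lt0.
  have : L (t *+ (m + m')) <= M.
    apply: LM; rewrite mulrnDr (@le_lt_trans _ _ (t *+ m))//; last first.
      by rewrite mulNrn ltrN2 in ma.
    by rewrite gerDl mulrn_wle0// ltW.
  rewrite LMn leNgt mulrnDr (lt_le_trans m'M)// lerDr mulrn_wge0//.
  exact: ltW.
have L_homo s t : s <= t -> L s <= L t.
  rewrite le_eqVlt => /predU1P[->//|st].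
  by rewrite -subr_le0 -LN -LD L_le0// subr_lt0.
have L1 : 0 <= L 1 by rewrite -oppr_le0 -LN L_le0// oppr_lt0.
have sandwich t (m : nat) : `|L t - t * L 1| *+ m <= L 1.
  have /andP[fl fr] := floor_itv (t *+ m).
  have := L_homo _ _ fl; have := L_homo _ _ (ltW fr).
  rewrite !LMz LMn => ub lb.
  have {}fl := ler_wpM2r L1 fl; have {}fr := ler_wpM2r L1 (ltW fr).
  move: lb ub fl fr; rewrite -![L 1 *~ _]mulrzl intrD !mulrDl !mul1r mulrnAl.
  set u := L t *+ m; set v := _ *+ m; set w := _ * _ => *.
  rewrite -normrMn mulrnBl -/u -/v ler_norml; apply/andP; split; lra.
move=> t; apply/eqP; rewrite -subr_eq0 -normr_le0 leNgt; apply/negP => t0.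
have [m] := multiples_unbounded _ (L 1) t0.
by rewrite ltNge sandwich.
Qed.

Section ComparisonOfTopologies.
Context (R : realType) (S : choiceType) (o : S) (d0 d : S -> S -> R).
Context (hd : is_metric d).
Context (hTop : forall u : nat -> option S,
  convergent (u : nat -> ext_space o d0) -> convergent (u : nat -> ext_space o d)).

(** Otherwise some sequence [s] tends to [p] for [d0] but stays at [d]-distance at
    least [e] from [p].  Interleaved with the constant [p] it still converges for
    [d0], hence for [d]; the constant subsequence and [s] then share their
    [d]-limit, which is impossible, whether this limit is finite or infinity. *)
Lemma identity_continuous (p : S) (e : R) : d0 p p = 0 -> 0 < e ->
  exists2 delta, 0 < delta & forall q, d0 p q < delta -> d p q < e.
Proof.
move=> pp e0; apply/not_exists2P => far.
have /choice[s sP] : forall m : nat, exists q, d0 p q < m.+1%:R^-1 /\ e <= d p q.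
  move=> m; have [[]|] := far m.+1%:R^-1; first by rewrite invr_gt0.
  by move=> /existsNP[q /not_implyP[pq /negP]]; rewrite -leNgt => ?; exists q.
pose u m : option S := Some (if odd m then s m else p).
have [l ul] : convergent (u : nat -> ext_space o d).
  apply: hTop; exists (Some p) => A [U [[oU _] Up UA]].
  have [r r0 rU] := oU _ Up.
  exists (Num.bound r^-1) => // m /= rm; apply/UA/rU.
  case: ifP => _; last by rewrite pp.
  apply: lt_le_trans (sP m).1 _; rewrite invf_ple ?posrE//.
  rewrite (@le_trans _ _ (Num.bound r^-1)%:R) ?ler_nat ?leqW//.
  by apply/ltW/archi_boundP; rewrite invr_ge0 ltW.
case: l ul => [x|] ul.
- have nearx r : 0 < r -> exists N : nat,
      forall m, (N <= m)%N -> d x (if odd m then s m else p) < r.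
    move=> r0; have /ul[N _ NA] : nbhs (Some x : ext_space o d)
        [set y | exists2 q, y = Some q & d x q < r].
      by apply/(ext_nbhs_fin hd); exists r => // q xq; exists q.
    by exists N => m Nm; have [q [->]] := NA _ Nm.
  have [N Nx] := nearx (e / 2) ltac:(lra).
  have := Nx N.*2 ltac:(by rewrite -addnn leq_addr).
  have := Nx N.*2.+1 ltac:(by rewrite leqW// -addnn leq_addr).
  rewrite /= odd_double /= => xs xp; have := (sP N.*2.+1).2.
  have := Defs.metric_triangle hd p x (s N.*2.+1).
  rewrite (Defs.metric_sym hd p x); lra.
- have /ul[N _ NA] : nbhs (None : ext_space o d) [set y | y != Some p].
    apply/(ext_nbhs_infty hd); split=> //; exists (d o p + 1) => [|q].
      by rewrite ltr_wpDl// metric_ge0.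
    by move=> + /=; apply: contraTN => /eqP[->]; rewrite -leNgt lerDl.
  have := NA N.*2 ltac:(by rewrite /= -addnn leq_addr).
  by rewrite /u /= odd_double eqxx.
Qed.
End ComparisonOfTopologies.

(** * Metrics for which the Korányi similarities are similarities *)

Section InvariantMetric.
Context (R : realType) (K : division_algebra) (n : nat).
Local Notation heis := (heis R K n).
Local Notation o := (heis_o R K n).
Local Notation dil := (@heis_dil R K n).
Context (d : heis -> heis -> R) (hd : is_metric d).
Context (hSim : similarity o (@koranyi_dist R K n) `<=` similarity o d).

(** (Sim) speaks of maps of the compactified group; this is what it says about the
    group itself. *)
Lemma similarity_scales k f g : cancel f g -> cancel g f ->
  scales (@koranyi_dist R K n) k f -> proper_at_infty o (@koranyi_dist R K n) f ->
  proper_at_infty o (@koranyi_dist R K n) g -> exists l, scales d l f.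
Proof.
move=> fK gK kf fp gp; have [_ [l l0 lP]] := hSim (similarity_omap fK gK kf fp gp).
by exists l; split=> // p q; have [] := lP p q.
Qed.

Lemma scales_uniq k l f p : p != o -> scales d k f -> scales d l f -> k = l.
Proof.
move=> po [_ kf] [_ lf]; apply: (@mulIf _ (d o p)); last by rewrite -kf lf.
by apply: contra po => /eqP/(metric_eq0 hd) <-.
Qed.

Lemma transl_proper a : proper_at_infty o (@koranyi_dist R K n) (heis_mul a).
Proof.
move=> r; have [r' r'0 r'P] := koranyi_gauge_mul_bounded (heis_inv a) r.
exists r' => [//|q]; rewrite !koranyi_distol !ltNge; apply: contra.
by move=> /r'P; rewrite heis_mulK.
Qed.

Lemma transl_scales a : exists k, scales d k (heis_mul a).
Proof.
apply: (@similarity_scales 1 _ _ (heis_mulK a) (heis_mulVK a)); last 2 first.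
- exact: transl_proper.
- exact: transl_proper.
by split=> // p q; rewrite mul1r koranyi_distMl.
Qed.

Lemma dil_scales r : 0 < r -> exists k, scales d k (dil r).
Proof.
have kdil s : 0 < s -> scales (@koranyi_dist R K n) s (heis_dil s).
  by move=> s0; split=> // p q; rewrite koranyi_dist_dil// ltW.
move=> r0; have r_neq0 : r != 0 by rewrite gt_eqF.
have ri0 : 0 < r^-1 by rewrite invr_gt0.
apply: (@similarity_scales r _ (dil r^-1)).
- exact: heis_dilK.
- by rewrite -{2}[r]invrK; apply: heis_dilK; rewrite gt_eqF.
- exact: kdil.
- exact: scales_proper (kdil _ r0) (heis_dilo _ _ _).
- exact: scales_proper (kdil _ ri0) (heis_dilo _ _ _).
Qed.

(** The translation by [dil 2 a] is the conjugate of the translation by [a] by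
    [dil 2], so it has the same ratio [k].  If it is also the iterate of order
    [m.+2], then [k ^+ m.+2 = k], and [k > 0] gives [k = 1]. *)
Lemma transl_isometry_of_pow m a p0 : p0 != o ->
  (forall p, heis_mul (dil 2 a) p = iter m.+2 (heis_mul a) p) ->
  scales d 1 (heis_mul a).
Proof.
move=> p00 aP.
have [k ka] := transl_scales a; have [l l2] := dil_scales (ltr0n R 2).
have kiter i : scales d (k ^+ i) (iter i (heis_mul a)).
  elim: i => [|i IH]; first by split=> // p q; rewrite mul1r.
  by rewrite exprS; exact: scales_comp ka IH.
have kconj : scales d k (heis_mul (dil 2 a)).
  split=> [|p q]; first exact: ka.1.
  have dilVK x : x = dil 2 (dil 2^-1 x) by rewrite heis_dilA divff// heis_dil1.
  rewrite (dilVK p) (dilVK q) -!heis_dilM !l2.2 ka.2; exact: mulrCA.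
suff k1 : k = 1 by rewrite -k1.
have kX : k ^+ m.+2 = k.
  apply: (scales_uniq p00) kconj; have [k0 kk] := kiter m.+2.
  by split=> // p q; rewrite !aP kk.
have /eqP : k ^+ m.+1 = 1.
  by apply: (mulfI (_ : k != 0)); rewrite ?gt_eqF ?ka.1// mulr1 -exprS.
by rewrite pexpr_eq1 ?ltW ?ka.1// => /eqP.
Qed.

(** In a horizontal or a vertical one-parameter subgroup, [dil 2] is the squaring
    or the fourth power; these two kinds of elements generate the group. *)
Lemma transl_isometry p0 a : p0 != o -> scales d 1 (heis_mul a).
Proof.
move=> p00.
(* exponent 2, hence [m = 0] *)
have horizontal z : scales d 1 (heis_mul ((z, 0) : heis)).
  apply: (@transl_isometry_of_pow 0 _ p0) => // p /=; rewrite heis_mulA.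
  congr heis_mul; rewrite /heis_dil /heis_mul /= heis_omega_alt !scaler0 !addr0.
  by rewrite scaler_nat mulr2n.
(* exponent 4, hence [m = 2] *)
have vertical v : scales d 1 (heis_mul ((0, v) : heis)).
  apply: (@transl_isometry_of_pow 2 _ p0) => // p /=; rewrite !heis_mulA.
  congr heis_mul; rewrite /heis_dil /heis_mul /= !(heis_omega0l, scaler0, addr0).
  by rewrite -natrX scaler_nat -[(2 ^ 2)%N]/4%N !mulrS mulr0n addr0 !addrA.
have -> : heis_mul a = heis_mul ((a.1, 0) : heis) \o heis_mul ((0, a.2) : heis).
  apply/funext => p /=; rewrite heis_mulA; congr heis_mul.
  by case: a => z v; rewrite /heis_mul /= heis_omega0r scaler0 !addr0 add0r.
by rewrite -[1]mulr1; apply: scales_comp.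
Qed.

Lemma dist_transl p0 p q : p0 != o -> d p q = d o (heis_mul (heis_inv q) p).
Proof.
move=> /(transl_isometry (heis_inv q))[_ qP].
rewrite -[LHS]mul1r -qP (Defs.metric_sym hd); congr d.
by have := heis_mulK q o; rewrite heis_mul0.
Qed.

Context (hTop : forall u : nat -> option heis,
  convergent (u : nat -> ext_space o (@koranyi_dist R K n)) ->
  convergent (u : nat -> ext_space o d)).

Lemma gauge_small e : 0 < e -> exists2 delta, 0 < delta &
  forall p, koranyi_gauge p < delta -> d o p < e.
Proof.
move=> e0; have [||delta delta0 dP] := @identity_continuous _ _ _ _ _ hd hTop o e => //.
  by rewrite koranyi_distol; apply/eqP; rewrite koranyi_gauge_eq0.
by exists delta => // p pd; apply: dP; rewrite koranyi_distol.
Qed.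

(** The logarithm of the ratio, as a function of the logarithm of the factor, is
    additive, and it is bounded above near minus infinity by [gauge_small]. *)
Lemma dil_scales_powR (z : {ffun 'I_n.-1 -> alg R K}) : z != 0 ->
  exists2 alpha : R, 0 < alpha <= 1 &
  forall r, 0 < r -> scales d (r `^ alpha) (dil r).
Proof.
move=> z0; pose e : heis := (z, 0).
have eo : e != o by apply: contra z0 => /eqP[->].
have doe : 0 < d o e.
  rewrite lt_neqAle Defs.metric_ge0// andbT eq_sym.
  by apply: contra eo => /eqP/(metric_eq0 hd) <-.
have ge : 0 < koranyi_gauge e.
  by rewrite lt_neqAle koranyi_gauge_ge0 andbT eq_sym koranyi_gauge_eq0.
have /choice[k kP] : forall r, exists k, 0 < r -> scales d k (dil r).
  move=> r; have [r0|//] := pselect (0 < r); last by exists 0.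
  by have [k kr] := dil_scales r0; exists k.
have kM r s : 0 < r -> 0 < s -> k (r * s) = k r * k s.
  move=> r0 s0; apply: (scales_uniq eo (kP _ (mulr_gt0 r0 s0))).
  have [k0 kk] := scales_comp (kP _ r0) (kP _ s0); split=> // p q.
  by rewrite -!heis_dilA kk.
have k_small c : 0 < c -> exists2 eps, 0 < eps & forall r, 0 < r < eps -> k r < c.
  move=> c0; have [delta delta0 dP] := gauge_small (mulr_gt0 c0 doe).
  exists (delta / koranyi_gauge e) => [|r /andP[r0 re]]; first exact: divr_gt0.
  rewrite -(ltr_pM2r doe) -(kP _ r0).2 heis_dilo dP//.
  by rewrite koranyi_gauge_dil ?ltW// -ltr_pdivlMr.
pose L t := ln (k (expR t)).
have kE : exists a, forall r, 0 < r -> k r = r `^ a.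
  have [eps eps0 epsP] := k_small 1 ltr01.
  have LD s t : L (s + t) = L s + L t.
    by rewrite /L expRD kM ?expR_gt0// lnM ?posrE// (kP _ _).1 ?expR_gt0.
  have LM t : t < ln eps -> L t <= 0.
    rewrite -ltr_expR lnK ?posrE// => te.
    by rewrite /L ln_le0// ltW// epsP// expR_gt0.
  exists (L 1) => r r0; rewrite /powR gt_eqF// mulrC.
  rewrite -(additive_bounded_above_linear LD LM) /L.
  rewrite [expR (ln r)]lnK ?posrE// lnK ?posrE//.
  exact: (kP _ r0).1.
have {kE}[alpha kE] := kE; exists alpha; last first.
  by move=> r r0; rewrite -kE//; apply: kP.
apply/andP; split.
  have [eps eps0 epsP] := k_small 1 ltr01.
  pose r := Num.min 2^-1 (eps / 2).
  have r0 : 0 < r by rewrite lt_min invr_gt0 ltr0n divr_gt0.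
  have r1 : r < 1 by rewrite gt_min invf_lt1 ?ltr1n.
  have : k r < 1.
    by apply: epsP; rewrite r0 gt_min ltr_pdivrMr// ltr_pMr// ltr1n orbT.
  rewrite kE// /powR gt_eqF// expR_lt1 nmulr_llt0// ln_lt0//.
  by rewrite r0.
(* [dil 2 e = e * e] is reached from [o] by two steps of length [d o e]. *)
have : k 2 <= 2.
  rewrite -(ler_pM2r doe) -(kP _ (ltr0n R 2)).2 heis_dilo.
  have -> : dil 2 e = heis_mul e e.
    rewrite /heis_dil /heis_mul /= heis_omega_alt !scaler0 !addr0.
    by rewrite scaler_nat mulr2n.
  rewrite (le_trans (Defs.metric_triangle hd _ e _))// mulr2n mulrDl mul1r lerD2l.
  by have := (transl_isometry e eo).2 o e; rewrite heis_mul0 mul1r => ->.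
rewrite kE// -{2}[2]powRr1// /powR !gt_eqF// ler_expR ler_pM2r//.
by rewrite ln_gt0// ltr1n.
Qed.

(** Every [p] other than [o] is the dilate, of factor proportional to its gauge, of
    a point of gauge [delta / 2], whose [d]-distance to [o] is less than 1.  The
    vector [z] only witnesses that the group is not trivial. *)
Lemma gauge_upper_bound (z : {ffun 'I_n.-1 -> alg R K}) : z != 0 ->
  exists alpha beta : R, [/\ 0 < alpha <= 1, 0 < beta &
    forall p q, d p q <= beta * koranyi_dist p q `^ alpha].
Proof.
move=> z0; have [alpha a01 dilP] := dil_scales_powR z0; have /andP[a0 _] := a01.
have [delta delta0 dP] := gauge_small ltr01.
exists alpha, ((2 / delta) `^ alpha); split=> // [|p q].
  by rewrite powR_gt0// divr_gt0.
rewrite (@dist_transl (z, 0)); last by apply: contra z0 => /eqP[->].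
rewrite /koranyi_dist; move: (heis_mul _ p) => {q}p.
have [->|po] := eqVneq p o.
  rewrite (metric_eq0 hd _ _).2// mulr_ge0// powR_ge0//.
have g0 : 0 < koranyi_gauge p.
  by rewrite lt_neqAle koranyi_gauge_ge0 andbT eq_sym koranyi_gauge_eq0.
have c0 : 0 < 2 / delta by exact: divr_gt0.
set s := 2 / delta * koranyi_gauge p.
have s0 : 0 < s by exact: mulr_gt0.
have -> : d o p = s `^ alpha * d o (dil s^-1 p).
  by rewrite -(dilP _ s0).2 heis_dilo heis_dilA divff ?gt_eqF// heis_dil1.
rewrite -powRM ?koranyi_gauge_ge0 ?(ltW c0)//.
rewrite -/s -[leRHS]mulr1 ler_pM2l ?powR_gt0// ltW// dP//.
rewrite koranyi_gauge_dil ?invr_ge0 ?ltW//.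
by rewrite /s invfM mulfVK ?gt_eqF// invf_div ltr_pdivrMr// ltr_pMr// ltr1n.
Qed.

End InvariantMetric.

(** * The real case *)

Section RealCase.
Context (R : realType) (n : nat).
Local Notation heis := (heis R Reals n).
Local Notation o := (heis_o R Reals n).
Implicit Types (x y z : {ffun 'I_n.-1 -> alg R Reals}) (p q : heis).

Definition dot x y : R := \sum_i (x i : R) * (y i : R).

Lemma dotC x y : dot x y = dot y x.
Proof. by apply: eq_bigr => i _; rewrite mulrC. Qed.

Lemma dot_linear x : linear_for *%R (dot x).
Proof.
move=> a y z; rewrite /dot mulr_sumr -big_split; apply: eq_bigr => i _ /=.
by rewrite !ffunE mulrDr mulrCA.
Qed.

HB.instance Definition _ x :=
  GRing.isLinear.Build R {ffun 'I_n.-1 -> alg R Reals} R _ (dot x) (dot_linear x).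

Lemma heis_normsq_dot x : heis_normsq x = dot x x.
Proof. by rewrite heis_normsqE; apply: eq_bigr => i _; rewrite -expr2. Qed.

(** For [u = 0] this is the identity, whatever the value of the quotient, so the
    statements below need no hypothesis on [u]. *)
Definition reflection u x := x - (2 * dot u x / dot u u) *: u.

Lemma reflection_linear u : linear (reflection u).
Proof.
move=> a x y; rewrite /reflection linearP /= mulrDr mulrDl scalerDl opprD addrACA.
by rewrite scalerBr scalerA mulrCA !mulrA.
Qed.

HB.instance Definition _ u :=
  GRing.isLinear.Build R {ffun 'I_n.-1 -> alg R Reals}
    {ffun 'I_n.-1 -> alg R Reals} _ (reflection u) (reflection_linear u).

Lemma dot_eq0 u : (dot u u == 0) = (u == 0).
Proof. by rewrite -heis_normsq_dot heis_normsq_eq0. Qed.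

Lemma dot_reflection u x : dot u (reflection u x) = - dot u x.
Proof.
have [->|u0] := eqVneq u 0; first by rewrite dotC linear0 dotC linear0 oppr0.
rewrite linearB linearZ /= mulfVK ?dot_eq0//; ring.
Qed.

Lemma reflectionK u : involutive (reflection u).
Proof.
move=> x; rewrite {1}/reflection dot_reflection mulrN mulNr scaleNr opprK.
by rewrite /reflection subrK.
Qed.

Lemma heis_normsq_reflection u x : heis_normsq (reflection u x) = heis_normsq x.
Proof.
rewrite !heis_normsq_dot {2}/reflection linearB linearZ /= (dotC _ u).
rewrite dot_reflection dotC linearB linearZ /= (dotC x u); ring.
Qed.

Lemma reflection_swap x y : heis_normsq x = heis_normsq y ->
  reflection (x - y) x = y.
Proof.
rewrite !heis_normsq_dot => xy.
have [/eqP|xy0] := eqVneq (x - y) 0.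
  by rewrite subr_eq0 => /eqP ->; rewrite subrr /reflection scaler0 subr0.
have -> : reflection (x - y) x = x - 1 *: (x - y); last first.
  by rewrite scale1r opprB addrC subrK.
(* For [x] and [y] of the same length, [dot (x - y) (x - y)] is twice
   [dot (x - y) x], so the coefficient is 1. *)
rewrite /reflection; congr (_ - _ *: _); apply/eqP.
rewrite -subr_eq0 -{2}[1](@divff _ (dot (x - y) (x - y))) ?dot_eq0//.
rewrite -mulrBl mulf_eq0; apply/orP; left; apply/eqP.
rewrite linearB /= ![dot (x - y) _]dotC !linearB /= (dotC y x) xy; ring.
Qed.

Lemma im_space_real (v : im_space R (cd_level Reals)) : v = 0.
Proof.
apply: val_inj; case: v => v /= /eqP /=.
move/eqP; rewrite -addr_eq0 -mulr2n -scaler_nat scaler_eq0 pnatr_eq0 /= => /eqP ->.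
by [].
Qed.

Definition heis_reflection u p : heis := (reflection u p.1, p.2).

Lemma koranyi_dist_reflection u p q :
  koranyi_dist (heis_reflection u p) (heis_reflection u q) = koranyi_dist p q.
Proof.
have -> : koranyi_dist (heis_reflection u p) (heis_reflection u q) =
          koranyi_gauge (heis_reflection u (heis_mul (heis_inv q) p)).
  rewrite /koranyi_dist /heis_reflection /heis_mul /=.
  congr koranyi_gauge; congr pair; last first.
    exact: etrans (im_space_real _) (esym (im_space_real _)).
  by rewrite [RHS]linearD (linearN (reflection u)).
by rewrite /koranyi_dist /koranyi_gauge /= heis_normsq_reflection.
Qed.

Context (d : heis -> heis -> R) (hd : is_metric d).
Context (hSim : similarity o (@koranyi_dist R Reals n) `<=` similarity o d).

(** The square of a reflection is the identity, so its ratio is 1. *)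
Lemma reflection_isometry u p : d o (heis_reflection u p) = d o p.
Proof.
have [->|po] := eqVneq p o.
  by rewrite /heis_reflection /= linear0.
have fK : involutive (heis_reflection u).
  by case=> x v; rewrite /heis_reflection /= reflectionK.
have fo : heis_reflection u o = o by rewrite /heis_reflection linear0.
have f1 : scales (@koranyi_dist R Reals n) 1 (heis_reflection u).
  by split=> // x y; rewrite koranyi_dist_reflection mul1r.
have [|l lf] := similarity_scales hSim fK fK f1 (scales_proper f1 fo).
  exact: scales_proper f1 fo.
have l1 : l = 1.
  have /eqP : l * l = 1.
    apply: (scales_uniq hd po (scales_comp lf lf)).
    by split=> // x y; rewrite mul1r /= !fK.
  by rewrite -expr2 sqrp_eq1 ?ltW ?lf.1// => /eqP.
by rewrite -{1}fo lf.2 l1 mul1r.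
Qed.

Lemma dist_normsq p q : heis_normsq p.1 = heis_normsq q.1 -> d o p = d o q.
Proof.
move=> pq; rewrite -(reflection_isometry (p.1 - q.1)) /heis_reflection.
rewrite reflection_swap//; congr d; case: q pq => x v _ /=.
by rewrite (im_space_real p.2) (im_space_real v).
Qed.

Context (hTop : forall u : nat -> option heis,
  convergent (u : nat -> ext_space o (@koranyi_dist R Reals n)) ->
  convergent (u : nat -> ext_space o d)).

(** Every [p] other than [o] has the gauge of a dilate of the fixed vector [e], and
    the ratio of the dilation gives the power law. *)
Lemma real_snowflake z : z != 0 ->
  exists beta alpha : R, [/\ 0 < beta, 0 < alpha <= 1 &
    forall p q, d p q = beta * koranyi_dist p q `^ alpha].
Proof.
move=> z0; have [alpha a01 dilP] := dil_scales_powR hd hSim hTop z0.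
have /andP[a0 _] := a01; pose e : heis := (z, 0).
have eo : e != o by apply: contra z0 => /eqP[->].
have ge : 0 < koranyi_gauge e.
  by rewrite lt_neqAle koranyi_gauge_ge0 andbT eq_sym koranyi_gauge_eq0.
exists (d o e / koranyi_gauge e `^ alpha), alpha; split=> // [|p q].
  apply: divr_gt0; last exact: powR_gt0.
  rewrite lt_neqAle Defs.metric_ge0// andbT eq_sym.
  by apply: contra eo => /eqP/(metric_eq0 hd) <-.
rewrite (dist_transl hd hSim p q eo) /koranyi_dist.
move: (heis_mul _ p) => {q}p; have [->|po] := eqVneq p o.
  have /eqP -> : koranyi_gauge o == 0 by rewrite koranyi_gauge_eq0.
  by rewrite (metric_eq0 hd _ _).2// powR0 ?gt_eqF// mulr0.
have g0 : 0 < koranyi_gauge p.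
  by rewrite lt_neqAle koranyi_gauge_ge0 andbT eq_sym koranyi_gauge_eq0.
pose s := koranyi_gauge p / koranyi_gauge e.
have s0 : 0 < s by exact: divr_gt0.
have same_gauge : koranyi_gauge (heis_dil s e) = koranyi_gauge p.
  by rewrite koranyi_gauge_dil ?ltW// divfK// gt_eqF.
rewrite (@dist_normsq p (heis_dil s e)); last first.
  apply/eqP; rewrite -(@eqrXn2 _ 2) ?heis_normsq_ge0//; apply/eqP.
  have : koranyi_gauge p ^+ 4 = koranyi_gauge (heis_dil s e) ^+ 4.
    by rewrite same_gauge.
  rewrite !koranyi_gaugeX4 (im_space_real p.2) (im_space_real (heis_dil s e).2).
  by move/addIr.
rewrite -{1}(heis_dilo _ _ s) (dilP _ s0).2.
rewrite -same_gauge koranyi_gauge_dil ?ltW// powRM ?(ltW s0) ?(ltW ge)//.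
have : koranyi_gauge e `^ alpha != 0 by rewrite gt_eqF// powR_gt0.
move: (s `^ alpha) (d o e) (koranyi_gauge e `^ alpha) => A D B B0.
by field.
Qed.

End RealCase.

(** Reduces estimates on the compactified group to finite points: with [alpha] and
    [beta] positive, the values [+oo] and [0] involving infinity are kept. *)
Lemma ext_dist_powR (R : realType) (S : Type) (d : S -> S -> R) (alpha beta : R)
    (p q : option S) : 0 < alpha -> 0 < beta ->
  (beta%:E * ext_dist d p q `^ alpha)%E =
  ext_dist (fun x y => beta * d x y `^ alpha) p q.
Proof.
move=> a0 b0; case: p q => [p|] [q|] /=.
- by rewrite EFinM.
- by rewrite gt_eqF// gt0_muley ?lte_fin.
- by rewrite gt_eqF// gt0_muley ?lte_fin.
- by rewrite powR0 ?gt_eqF// mule0.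
Qed.

Theorem theorem1p1 (R : realType) (K : division_algebra) (n : nat)
    (hn : (2 <= n)%N) (hO : K = Octonions -> n = 2%N)
    (d : heis R K n -> heis R K n -> R) (hd : is_metric d)
    (hSim : similarity (heis_o R K n) (@koranyi_dist R K n) `<=`
            similarity (heis_o R K n) d)
    (hTop : forall u : nat -> option (heis R K n),
       convergent (u : nat -> ext_space (heis_o R K n) (@koranyi_dist R K n)) ->
       convergent (u : nat -> ext_space (heis_o R K n) d)) :
  (K = Reals ->
     exists beta alpha : R, [/\ 0 < beta, 0 < alpha <= 1 &
       forall p q : option (heis R K n),
         ext_dist d p q =
           (beta%:E * (ext_dist (@koranyi_dist R K n) p q) `^ alpha)%E]) /\
  (K <> Reals ->
     exists alpha beta : R, [/\ 0 < alpha <= 1, 0 < beta &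
       forall p q : option (heis R K n),
         (ext_dist d p q <=
           beta%:E * (ext_dist (@koranyi_dist R K n) p q) `^ alpha)%E]).
Proof.
have [z z0] : exists z : {ffun 'I_n.-1 -> alg R K}, z != 0.
  have [c c0] := cd_neq0 R (cd_level K).
  have i0 : 'I_n.-1 by move: hn; clear; case: n => [|[|m]] // _; exact: ord0.
  by exists [ffun=> c]; apply: contra c0 => /eqP/ffunP/(_ i0); rewrite !ffunE => ->.
split=> [KR|_].
  move: d hd hSim hTop z z0; rewrite {}KR => d' hd' hSim' hTop' z z0.
  have [beta [alpha [b0 a01 dE]]] := real_snowflake hd' hSim' hTop' z0.
  have /andP[a0 _] := a01; exists beta, alpha; split=> // p q.
  by rewrite ext_dist_powR//; case: p q => [p|] [q|] //=; rewrite dE.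
have [alpha [beta [a01 b0 dle]]] := gauge_upper_bound hd hSim hTop z0.
have /andP[a0 _] := a01; exists alpha, beta; split=> // p q.
by rewrite ext_dist_powR//; case: p q => [p|] [q|] //=; rewrite lee_fin.
Qed.
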